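(* Let $\mathcal{A}_I = ((\mathfrak{A}_\hbar,\phi^I_\hbar)_{\hbar\in I},\mathfrak{A})$ be a $UC_b$ bundle of C*-algebras over a locally compact metric space $I$. Let $J$ be a locally compact metric space and suppose $\alpha: I\to J$ is a dense, isometric embedding. Then there exists a minimal extension $\tilde{\mathcal{A}}_J$ of $\mathcal{A}_I$ associated with $\alpha$.
   Context: For a metric space $I$, $UC_b(I)$ is the C*-algebra of bounded uniformly continuous functions $I\to\mathbb{C}$. C*-algebras are not assumed unital. A $UC_b$ bundle of C*-algebras over a metric space $I$, written $((\mathfrak{A}_\hbar,\phi^I_\hbar)_{\hbar\in I},\mathfrak{A})$, is a family of C*-algebras $(\mathfrak{A}_\hbar)_{\hbar\in I}$, a C*-algebra $\mathfrak{A}$ (the uniformly continuous sections), and *-homomorphisms $\phi^I_\hbar:\mathfrak{A}\to\mathfrak{A}_\hbar$ (evaluation maps) such that: (i) each $\phi^I_\hbar$ is surjective and $\|a\|=\sup_{\hbar\in I}\|\phi^I_\hbar(a)\|_\hbar$ for all $a\in\mathfrak{A}$; (ii) for each $f\in UC_b(I)$ and $a\in\mathfrak{A}$ there is an element $fa\in\mathfrak{A}$ with $\phi^I_\hbar(fa)=f(\hbar)\phi^I_\hbar(a)$ for all $\hbar\in I$; (iii) for each $a\in\mathfrak{A}$, the function $\hbar\mapsto\|\phi^I_\hbar(a)\|_\hbar$ is in $UC_b(I)$. A homomorphism from $\mathcal{A}_I=((\mathfrak{A}_\hbar,\phi^I_\hbar)_{\hbar\in I},\mathfrak{A})$ to $\mathcal{B}_J=((\mathfrak{B}_\hbar,\phi^J_\hbar)_{\hbar\in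 J},\mathfrak{B})$ is a pair $\sigma=(\alpha,\beta)$ where $\alpha:I\to J$ is a metric map (i.e. $d_J(\alpha(x),\alpha(y))\le d_I(x,y)$ for all $x,y\in I$), $\beta:\mathfrak{A}\to\mathfrak{B}$ is a *-homomorphism, and for all $a_1,a_2\in\mathfrak{A}$ and $\hbar\in I$: if $\phi^I_\hbar(a_1)=\phi^I_\hbar(a_2)$, then $\phi^J_{\alpha(\hbar)}(\beta(a_1))=\phi^J_{\alpha(\hbar)}(\beta(a_2))$. Let $\mathcal{A}_I$, $\mathcal{B}_J$ be $UC_b$ bundles over locally compact metric spaces. $\mathcal{B}_J$ is an extension of $\mathcal{A}_I$ (associated with $\alpha$ via $\sigma$) if there is a monomorphism $\sigma=(\alpha,\beta):\mathcal{A}_I\to\mathcal{B}_J$, i.e. a homomorphism with $\alpha$ and $\beta$ both injective. It is a minimal extension if, moreover, $\alpha$ and $\beta$ are dense embeddings: $\alpha$ is an isometry onto its image and $\alpha[I]$ is dense in $J$; $\beta[\mathfrak{A}]$ is norm dense in $\mathfrak{B}$. A dense, isometric embedding $\alpha:I\to J$ is a map that is an isometry onto its image and has dense image (it need not be bijective). *)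

(* Defs.v *)
From HB Require Import structures.
From mathcomp Require Import all_boot all_order all_algebra.
From mathcomp Require Import complex.
From mathcomp Require Import all_classical all_reals all_analysis.

Set Implicit Arguments.
Unset Strict Implicit.
Unset Printing Implicit Defensive.

Import Order.TTheory GRing.Theory Num.Theory.
Import numFieldNormedType.Exports.

Local Open Scope classical_set_scope.
Local Open Scope ring_scope.
Local Open Scope complex_scope.

(* C*-algebras over the complex field R[i].  There is no unit: [nzRingType] and
   [pzRingType] would impose one, so the product is a separate operation on a
   Banach space.  The norm of a [normedModType R[i]] takes its values in R[i]
   (they are nonnegative, hence real). *)
HB.mixin Record isCStarAlgebra (R : realType) A
    & CompleteNormedModule R[i] A := {
  cmul : A -> A -> A ;
  cstar : A -> A ;
  cmulA : forall x y z : A, cmul x (cmul y z) = cmul (cmul x y) z ;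
  cmulDl : forall x y z : A, cmul (x + y) z = cmul x z + cmul y z ;
  cmulDr : forall x y z : A, cmul x (y + z) = cmul x y + cmul x z ;
  cmulZl : forall (c : R[i]) (x y : A), cmul (c *: x) y = c *: cmul x y ;
  cmulZr : forall (c : R[i]) (x y : A), cmul x (c *: y) = c *: cmul x y ;
  cstarD : forall x y : A, cstar (x + y) = cstar x + cstar y ;
  cstarZ : forall (c : R[i]) (x : A), cstar (c *: x) = c^* *: cstar x ;
  cstarM : forall x y : A, cstar (cmul x y) = cmul (cstar y) (cstar x) ;
  cstarK : forall x : A, cstar (cstar x) = x ;
  cnormM : forall x y : A, `|cmul x y| <= `|x| * `|y| ;
  cnormC : forall x : A, `|cmul (cstar x) x| = `|x| ^+ 2
}.

#[short(type="cstarAlgType")]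
HB.structure Definition CStarAlgebra (R : realType) :=
  {A of CompleteNormedModule R[i] A & isCStarAlgebra R A}.

Section star_homomorphisms.
Context {R : realType} {A B : cstarAlgType R}.

Definition star_hom (f : A -> B) : Prop :=
  [/\ linear f,
      (forall x y, f (cmul x y) = cmul (f x) (f y)) &
      (forall x, f (cstar x) = cstar (f x))].

End star_homomorphisms.

Definition rnorm {R : realType} {A : cstarAlgType R} (a : A) : R :=
  complex.Re `|a|.

Definition UCb {R : realType} {I : metricType R} (f : I -> R[i]^o) : Prop :=
  unif_continuous f /\ bounded_fun f.

(* Pitfall: in [norm_evE], [sup] is a junk 0 on the empty set and on unbounded
   sets.  On the empty set 0 is the wanted value (a supremum of norms is taken
   in [0, +oo[); unboundedness is excluded by [norm_ev_UCb]. *)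
Record UCb_bundle (R : realType) (I : metricType R) := UCbBundle {
  fiber : I -> cstarAlgType R ;
  sections : cstarAlgType R ;
  ev : forall h : I, sections -> fiber h ;
  ev_hom : forall h : I, star_hom (ev h) ;
  ev_surj : forall (h : I) (b : fiber h), exists a : sections, ev h a = b ;
  norm_evE : forall a : sections,
    rnorm a = sup [set rnorm (ev h a) | h in [set: I]] ;
  ev_UCb_scale : forall (f : I -> R[i]^o) (a : sections), UCb f ->
    exists fa : sections, forall h : I, ev h fa = f h *: ev h a ;
  norm_ev_UCb : forall a : sections, UCb (fun h : I => `|ev h a|)
}.

Section bundle_homomorphisms.
Context {R : realType} {I J : metricType R}.
Variables (A : UCb_bundle I) (B : UCb_bundle J).

Definition metric_map (alpha : I -> J) : Prop :=
  forall x y : I, mdist (alpha x) (alpha y) <= mdist x y.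

Definition dense_isometric_embedding (alpha : I -> J) : Prop :=
  (forall x y : I, mdist (alpha x) (alpha y) = mdist x y) /\
  dense (range alpha).

Definition bundle_hom (alpha : I -> J) (beta : sections A -> sections B) : Prop :=
  [/\ metric_map alpha,
      star_hom beta &
      forall (a1 a2 : sections A) (h : I), ev h a1 = ev h a2 ->
        ev (alpha h) (beta a1) = ev (alpha h) (beta a2)].

Definition bundle_mono (alpha : I -> J) (beta : sections A -> sections B) : Prop :=
  [/\ bundle_hom alpha beta, injective alpha & injective beta].

Definition minimal_extension_via (alpha : I -> J)
    (beta : sections A -> sections B) : Prop :=
  [/\ bundle_mono alpha beta,
      dense_isometric_embedding alpha &
      dense (range beta)].

(* B is a minimal extension of A associated with alpha. *)
Definition minimal_extension (alpha : I -> J) : Prop :=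
  exists beta : sections A -> sections B, minimal_extension_via alpha beta.

End bundle_homomorphisms.

(* Main.v *)
Require Import Defs.
From HB Require Import structures.
From mathcomp Require Import all_boot all_order all_algebra.
From mathcomp Require Import generic_quotient ring_quotient.
From mathcomp Require Import complex.
From mathcomp Require Import all_classical all_reals all_analysis.
From mathcomp Require Import ring lra.

Set Implicit Arguments.
Unset Strict Implicit.
Unset Printing Implicit Defensive.

Import Order.TTheory GRing.Theory Num.Theory.
Import numFieldNormedType.Exports.

Local Open Scope classical_set_scope.
Local Open Scope ring_scope.
Local Open Scope complex_scope.
Local Open Scope quotient_scope.

(** The extension keeps the algebra of sections, beta being the identity; only
    fibres over the new points have to be supplied.  For a section [a], the
    function h |-> ||a(h)|| is uniformly continuous on I, so it extends by
    density to a uniformly continuous function N_a on J.  For fixed j the map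
    p_j : a |-> N_a(j) is a C*-seminorm, every law being a limit of the law in
    the fibres of I, and the fibre at j is the quotient of the algebra of
    sections by the kernel of p_j, normed by p_j ([quotient_seminorm],
    [quotient_alg], [limit_seminorm]).

    The point to settle is that this quotient is complete.  Injective
    *-homomorphisms of C*-algebras being isometric would give that p_j is the
    quotient norm, but the module structure over UC_b(I) gives it by hand
    ([limit_norm_lift]): if r = p_j(a) > 0, multiply [a] by the function
    r / max(r, ||a(h)||).  The product has norm at most r, and it differs from
    [a] by an element of the kernel of p_j, because the multiplier tends to 1 at
    j.  So every element of the quotient has a lift of the same norm; hence a
    fast Cauchy sequence of the quotient lifts to a Cauchy sequence of sections,
    and the quotient is complete ([quotient_complete]).

    The bundle axioms over J then follow by approximation.  Since alpha is
    isometric, p_(alpha h)(a) = ||a(h)|| ([fiber_seminorm_image]), which gives the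
    norm formula and shows that the identity is a bundle morphism; for f in
    UC_b(J), a section representing (f o alpha) a over I represents f a over
    J. *)

(** * Real-valued norms *)

Lemma ltr0c {R : realType} (r : R) : (0 < r%:C) = (0 < r).
Proof. exact: ltcR. Qed.

Lemma gt0_complex {R : realType} (e : R[i]) :
  0 < e -> exists2 r : R, 0 < r & e = r%:C.
Proof.
case: e => a b; rewrite ltcE /= => /andP[/eqP b0 a0].
by exists a => //; rewrite b0.
Qed.

Lemma normc_real {R : realType} (x : R) : `|x%:C| = (`|x|)%:C.
Proof. by rewrite normc_def /= expr0n addr0 sqrtr_sqr. Qed.

Section real_norms.
Context {R : realType}.

Lemma Re_normcK (c : R[i]) : (complex.Re `|c|)%:C = `|c|.
Proof. by rewrite RRe_real // ger0_real. Qed.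

Lemma Re_normc_ge0 (c : R[i]) : 0 <= complex.Re `|c|.
Proof. by rewrite -ler0c Re_normcK. Qed.

Context {A : cstarAlgType R}.
Implicit Types x y : A.

Lemma rnormK x : (rnorm x)%:C = `|x|.
Proof. by rewrite /rnorm RRe_real // ger0_real. Qed.

Lemma rnorm_ge0 x : 0 <= rnorm x.
Proof. by rewrite -ler0c rnormK. Qed.

Lemma rnormD x y : rnorm (x + y) <= rnorm x + rnorm y.
Proof. by rewrite -lecR rmorphD /= !rnormK ler_normD. Qed.

Lemma rnormZ (c : R[i]) x : rnorm (c *: x) = complex.Re `|c| * rnorm x.
Proof.
by apply: complexI; rewrite rmorphM /= !rnormK Re_normcK normrZ.
Qed.

Lemma rnormM x y : rnorm (cmul x y) <= rnorm x * rnorm y.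
Proof. by rewrite -lecR rmorphM /= !rnormK cnormM. Qed.

Lemma rnormC x : rnorm (cmul (cstar x) x) = rnorm x ^+ 2.
Proof. by apply: complexI; rewrite rmorphXn /= !rnormK cnormC. Qed.

Lemma rnorm0 : rnorm (0 : A) = 0.
Proof. by rewrite /rnorm normr0. Qed.

Lemma cmulBl x y z : cmul (x - y) z = cmul x z - cmul y z.
Proof. by rewrite cmulDl -scaleN1r cmulZl scaleN1r. Qed.

Lemma cmulBr x y z : cmul x (y - z) = cmul x y - cmul x z.
Proof. by rewrite cmulDr -scaleN1r cmulZr scaleN1r. Qed.

Lemma cstarB x y : cstar (x - y) = cstar x - cstar y.
Proof. by rewrite cstarD -scaleN1r cstarZ rmorphN1 scaleN1r. Qed.

End real_norms.

(** * The quotient of a C*-algebra by a C*-seminorm *)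

(** C*-seminorms for which the quotient map sends the closed unit ball onto the
    closed unit ball of the quotient.  The field [qnorm_lift] is the source of the
    completeness of the quotient by the kernel: it carries Cauchy sequences of the
    quotient back to the complete algebra above. *)
Record quotient_seminorm (R : realType) (A : cstarAlgType R) := QuotientSeminorm {
  qnorm :> A -> R ;
  qnormD : forall x y, qnorm (x + y) <= qnorm x + qnorm y ;
  qnormZ : forall c x, qnorm (c *: x) = complex.Re `|c| * qnorm x ;
  qnormM : forall x y, qnorm (cmul x y) <= qnorm x * qnorm y ;
  qnormC : forall x, qnorm (cmul (cstar x) x) = qnorm x ^+ 2 ;
  qnorm_le : forall x, qnorm x <= rnorm x ;
  qnorm_lift : forall x, exists2 y, qnorm (y - x) = 0 & rnorm y <= qnorm x
}.

Section seminorm_theory.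
Context {R : realType} {A : cstarAlgType R} (p : quotient_seminorm A).
Implicit Types x y : A.

Lemma qnorm0 : p 0 = 0.
Proof. by rewrite -(scale0r 0) qnormZ normr0 mul0r. Qed.

Lemma qnormN x : p (- x) = p x.
Proof. by rewrite -scaleN1r qnormZ normrN1 mul1r. Qed.

Lemma qnorm_ge0 x : 0 <= p x.
Proof. by have := qnormD p x (- x); rewrite subrr qnorm0 qnormN; lra. Qed.

(** With x' the adjoint of x, the C*-identity gives
    p(x)^2 = p(x' x) <= p(x') p(x), hence p(x) <= p(x'), and the adjoint of x' is
    x.  So the kernel is stable under the involution. *)
Lemma qnorm_star x : p (cstar x) = p x.
Proof.
have le_star y : p y <= p (cstar y).
  have [->|y0] := eqVneq (p y) 0; first exact: qnorm_ge0.
  have py : 0 < p y by rewrite lt_neqAle eq_sym y0 qnorm_ge0.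
  by rewrite -(ler_pM2r py) -expr2 -qnormC qnormM.
by apply/le_anti; rewrite le_star -{2}(cstarK x) le_star.
Qed.

Definition qker : {pred A} := fun x => p x == 0.

Lemma qkerE x : (x \in qker) = (p x == 0). Proof. by []. Qed.

Lemma qker_zmod_closed : zmod_closed qker.
Proof.
split=> [|x y]; rewrite !qkerE ?qnorm0 // => /eqP x0 /eqP y0.
rewrite eq_le qnorm_ge0 andbT.
by have := qnormD p x (- y); rewrite qnormN x0 y0 addr0.
Qed.

HB.instance Definition _ := GRing.isZmodClosed.Build A qker qker_zmod_closed.

Definition quotient_alg := Quotient.quot qker.

HB.instance Definition _ := GRing.Zmodule.on quotient_alg.

Definition qproj (x : A) : quotient_alg := \pi_(Quotient.quot qker) x.

(** The operations on the quotient are computed on chosen representatives; the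
    morphism laws of [qproj] show that the choice is immaterial, and transport
    every algebraic identity. *)
Definition qrepr (q : quotient_alg) : A := repr (q : Quotient.quot qker).

Lemma qreprK : cancel qrepr qproj.
Proof. exact: reprK. Qed.

Lemma qproj_eq x y : qproj x = qproj y <-> p (x - y) = 0.
Proof.
rewrite /qproj; split=> [/eqP|/eqP e]; first by rewrite -Quotient.idealrBE => /eqP.
by apply/eqP; rewrite -Quotient.idealrBE.
Qed.

Lemma qprojD x y : qproj (x + y) = qproj x + qproj y.
Proof. exact: pi_addr. Qed.

Lemma qprojN x : qproj (- x) = - qproj x.
Proof. exact: pi_oppr. Qed.

Lemma qproj0 : qproj 0 = 0.
Proof. exact: pi_zeror. Qed.

Lemma qnorm_qrepr x : p (qrepr (qproj x) - x) = 0.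
Proof. by apply/qproj_eq; rewrite qreprK. Qed.

Lemma qnorm_congr x y : p (x - y) = 0 -> p x = p y.
Proof.
move=> e; have := qnormD p (x - y) y; have := qnormD p (y - x) x.
by rewrite -(qnormN (y - x)) opprB !subrK e !add0r => ? ?; apply/le_anti/andP.
Qed.

Definition qscale c (q : quotient_alg) := qproj (c *: qrepr q).

Lemma qproj_qscale c x : qproj (c *: x) = qscale c (qproj x).
Proof.
by apply/qproj_eq; rewrite -scalerBr qnormZ -opprB qnormN qnorm_qrepr mulr0.
Qed.

Fact qscaleA a b q : qscale a (qscale b q) = qscale (a * b) q.
Proof. by rewrite -(qreprK q) -!qproj_qscale scalerA. Qed.

Fact qscale1 : left_id 1 qscale.
Proof. by move=> q; rewrite -(qreprK q) -!qproj_qscale scale1r. Qed.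

Fact qscaleDr : right_distributive qscale +%R.
Proof.
move=> c q r; rewrite -(qreprK q) -(qreprK r) -qprojD -!qproj_qscale.
by rewrite -qprojD scalerDr.
Qed.

Fact qscaleDl q : {morph qscale^~ q : a b / a + b}.
Proof. by move=> a b; rewrite -(qreprK q) -!qproj_qscale -qprojD scalerDl. Qed.

HB.instance Definition _ := GRing.Zmodule_isLmodule.Build R[i] quotient_alg
  qscaleA qscale1 qscaleDr qscaleDl.

Fact quotient_normD (q r : quotient_alg) :
  (p (qrepr (q + r)))%:C <= (p (qrepr q))%:C + (p (qrepr r))%:C.
Proof.
rewrite -rmorphD lecR -{1}(qreprK q) -{1}(qreprK r) -qprojD.
by rewrite (qnorm_congr (qnorm_qrepr _)) qnormD.
Qed.

Fact quotient_normZ c (q : quotient_alg) :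
  (p (qrepr (c *: q)))%:C = `|c| * (p (qrepr q))%:C.
Proof.
rewrite -{1}(qreprK q) -[c *: qproj _]qproj_qscale.
by rewrite (qnorm_congr (qnorm_qrepr _)) qnormZ rmorphM /= Re_normcK.
Qed.

Fact quotient_norm0_eq0 (q : quotient_alg) : (p (qrepr q))%:C = 0 -> q = 0.
Proof.
by move=> /complexI q0; rewrite -(qreprK q) -qproj0; apply/qproj_eq; rewrite subr0.
Qed.

HB.instance Definition _ := @Lmodule_isNormed.Build R[i] quotient_alg
  (fun q => (p (qrepr q))%:C) quotient_normD quotient_normZ quotient_norm0_eq0.

Lemma norm_qproj x : `|qproj x| = (p x)%:C.
Proof. by rewrite -(qnorm_congr (qnorm_qrepr x)). Qed.

Definition qmul (q r : quotient_alg) := qproj (cmul (qrepr q) (qrepr r)).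
Definition qstar (q : quotient_alg) := qproj (cstar (qrepr q)).

Lemma qprojM x y : qproj (cmul x y) = qmul (qproj x) (qproj y).
Proof.
(* One factor at a time: each difference is a product with a factor of
   seminorm 0. *)
transitivity (qproj (cmul x (qrepr (qproj y)))); apply/qproj_eq.
- apply/le_anti; rewrite qnorm_ge0 andbT -cmulBr (le_trans (qnormM _ _ _)) //.
  by rewrite -opprB qnormN qnorm_qrepr mulr0.
- apply/le_anti; rewrite qnorm_ge0 andbT -cmulBl (le_trans (qnormM _ _ _)) //.
  by rewrite -opprB qnormN qnorm_qrepr mul0r.
Qed.

Lemma qproj_star x : qproj (cstar x) = qstar (qproj x).
Proof.
by apply/qproj_eq; rewrite -cstarB qnorm_star -opprB qnormN qnorm_qrepr.
Qed.

Lemma qlift (q : quotient_alg) : exists y, qproj y = q /\ `|y| <= `|q|.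
Proof.
have [y yq le_y] := qnorm_lift p (qrepr q); exists y; split.
  by rewrite -[RHS]qreprK; apply/qproj_eq.
by rewrite -rnormK -[in leRHS](qreprK q) norm_qproj lecR.
Qed.

End seminorm_theory.

Lemma geometric_lt {R : realType} (K e : R) : 0 < e ->
  \forall n \near \oo, K * 2^-1 ^+ n < e.
Proof.
move=> e0; have : (fun n : nat => K * (2^-1 : R) ^+ n) @ \oo --> (K * 0 : R).
  apply: cvgMr; apply: cvg_expr.
  by rewrite ger0_norm ?invr_ge0 // invf_lt1 ?ltr1n.
by rewrite mulr0 => /cvgr_lt; apply; exact: e0.
Qed.

Lemma geometric_cvg {R : realType} {V : completeNormedModType R[i]}
    (a : nat -> V) (K : R) :
  (forall n, `|a n.+1 - a n| <= (K * 2^-1 ^+ n)%:C) -> cvg (a @ \oo).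
Proof.
move=> le_a.
(* The factor 2 is the sum of the geometric series of ratio 1/2. *)
have le_tail k n : `|a (n + k)%N - a n| <= (2 * K * 2^-1 ^+ n)%:C.
  elim: k n => [|k IH] n.
    rewrite addn0 subrr normr0 ler0c -mulrA mulr_ge0 // -ler0c.
    exact: le_trans (normr_ge0 _) (le_a n).
  rewrite -(subrK (a n.+1) (a _)) -addrA addnS -addSn.
  apply: le_trans (ler_normD _ _) _.
  apply: le_trans (lerD (IH n.+1) (le_a n)) _.
  by rewrite -rmorphD lecR exprS; lra.
apply/cauchy_cvgP/cauchy_exP => e /gt0_complex[r r0 ->].
have [N _ ltN] := geometric_lt (2 * K) r0.
exists (a N), N => //= n /subnKC <-.
rewrite -ball_normE /= distrC.
by rewrite (le_lt_trans (le_tail _ _)) // ltcR ltN /=.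
Qed.

Section quotient_complete.
Context {R : realType} {A : cstarAlgType R} (p : quotient_seminorm A).

Local Notation Q := (quotient_alg p).

(** The Cauchy filter is replaced by a sequence of centres b_n of balls of radius
    2^-n that belong to it.  Lifting the increments b_(n+1) - b_n, rather than the
    b_n themselves, without increasing their norms gives a sequence in the
    complete algebra above whose consecutive distances are summable. *)
Fact quotient_complete (F : set_system Q) : ProperFilter F -> cauchy F -> cvg F.
Proof.
move=> FF /cauchyP Fc.
have half0 n : 0 < (2^-1 ^+ n : R)%:C by rewrite ltr0c exprn_gt0.
have [b Fb] := choice (fun n => Fc _ (half0 n)).
(* Two members of a proper filter meet. *)
have le_b n : `|b n.+1 - b n| <= (2 * 2^-1 ^+ n)%:C.
  have [q []] := filter_ex (filterI (Fb n) (Fb n.+1)).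
  rewrite -!ball_normE /= => qn qn1; rewrite -(subrK q (b _)) -addrA.
  apply: le_trans (ler_normD _ _) _; rewrite -(distrC _ q).
  apply: le_trans (lerD (ltW qn1) (ltW qn)) _.
  rewrite -rmorphD lecR exprS.
  have : 0 < (2^-1 : R) ^+ n by rewrite exprn_gt0.
  lra.
have [s sP] := choice (@qlift _ _ p).
have sK q : qproj p (s q) = q by have [] := sP q.
have le_s q : `|s q| <= `|q| by have [] := sP q.
pose fix a n := if n is m.+1 then a m + s (b n - b m) else s (b 0%N).
have aK n : qproj p (a n) = b n.
  by elim: n => [|n IH] /=; rewrite ?qprojD ?IH sK // addrC subrK.
have /cvg_ex[l al] : cvg (a @ \oo).
  apply: (@geometric_cvg _ _ _ 2) => n /=.
  rewrite addrAC subrr add0r; exact: le_trans (le_s _) (le_b n).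
apply/cvg_ex; exists (qproj p l); apply/fcvgrPdist_lt => e /gt0_complex[r r0 ->].
have r20 : 0 < r / 2 by lra.
have near_a : \forall n \near \oo, `|l - a n| < (r / 2)%:C.
  by move/cvgrPdist_lt: al; apply; rewrite ltr0c.
have [n [an ltn]] := filter_ex (filterI near_a (geometric_lt 1 r20)).
apply: filterS (Fb n) => q; rewrite -ball_normE /= => qn.
rewrite -(subrK (b n) (qproj p l)) -addrA (le_lt_trans (ler_normD _ _)) //.
rewrite [r]splitr rmorphD; apply: ltrD.
  rewrite -aK -qprojN -qprojD norm_qproj (le_lt_trans _ an) // -rnormK lecR.
  exact: qnorm_le.
by rewrite (lt_trans qn) // ltcR -[ltLHS]mul1r.
Qed.

HB.instance Definition _ := Uniform_isComplete.Build Q quotient_complete.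

Local Notation pi := (qproj p).

Fact qmulA (x y z : Q) : qmul x (qmul y z) = qmul (qmul x y) z.
Proof.
by rewrite -(qreprK x) -(qreprK y) -(qreprK z) -!qprojM cmulA.
Qed.

Fact qmulDl (x y z : Q) : qmul (x + y) z = qmul x z + qmul y z.
Proof.
by rewrite -(qreprK x) -(qreprK y) -(qreprK z) -qprojD -!qprojM -qprojD cmulDl.
Qed.

Fact qmulDr (x y z : Q) : qmul x (y + z) = qmul x y + qmul x z.
Proof.
by rewrite -(qreprK x) -(qreprK y) -(qreprK z) -qprojD -!qprojM -qprojD cmulDr.
Qed.

Lemma qprojZ c x : pi (c *: x) = c *: pi x.
Proof. exact: qproj_qscale. Qed.

Fact qmulZl c (x y : Q) : qmul (c *: x) y = c *: qmul x y.
Proof.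
by rewrite -(qreprK x) -(qreprK y) -qprojZ -!qprojM -qprojZ cmulZl.
Qed.

Fact qmulZr c (x y : Q) : qmul x (c *: y) = c *: qmul x y.
Proof.
by rewrite -(qreprK x) -(qreprK y) -qprojZ -!qprojM -qprojZ cmulZr.
Qed.

Fact qstarD (x y : Q) : qstar (x + y) = qstar x + qstar y.
Proof.
by rewrite -(qreprK x) -(qreprK y) -qprojD -!qproj_star -qprojD cstarD.
Qed.

Fact qstarZ c (x : Q) : qstar (c *: x) = c^* *: qstar x.
Proof. by rewrite -(qreprK x) -qprojZ -!qproj_star -qprojZ cstarZ. Qed.

Fact qstarM (x y : Q) : qstar (qmul x y) = qmul (qstar y) (qstar x).
Proof. by rewrite -(qreprK x) -(qreprK y) -qprojM -!qproj_star -qprojM cstarM. Qed.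

Fact qstarK (x : Q) : qstar (qstar x) = x.
Proof. by rewrite -(qreprK x) -!qproj_star cstarK. Qed.

Fact qnormrM (x y : Q) : `|qmul x y| <= `|x| * `|y|.
Proof.
rewrite -(qreprK x) -(qreprK y) -qprojM !norm_qproj -rmorphM lecR.
exact: qnormM.
Qed.

Fact qnormrC (x : Q) : `|qmul (qstar x) x| = `|x| ^+ 2.
Proof.
by rewrite -(qreprK x) -qproj_star -qprojM !norm_qproj -rmorphXn /= qnormC.
Qed.

HB.instance Definition _ := isCStarAlgebra.Build R Q
  qmulA qmulDl qmulDr qmulZl qmulZr qstarD qstarZ qstarM qstarK qnormrM qnormrC.

Lemma qproj_star_hom : star_hom (pi : A -> (Q : cstarAlgType R)).
Proof.
split=> [c x y|x y|x]; [by rewrite qprojD qprojZ|exact: qprojM|exact: qproj_star].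
Qed.

Lemma rnorm_qproj x : rnorm (pi x : (Q : cstarAlgType R)) = p x.
Proof. by rewrite /rnorm norm_qproj. Qed.

End quotient_complete.

(** * The truncating multiplier *)

(** The function t |-> r / max(r, t) multiplies t into [0, r] and equals 1 for
    t <= r.  It is Lipschitz of constant 1 / r. *)
Section truncation.
Context {R : realType} (r : R).
Hypothesis r_gt0 : 0 < r.
Implicit Types s t e : R.

Let max_gt0 t : 0 < Num.max r t.
Proof. by rewrite lt_max r_gt0. Qed.

Lemma truncation_lipschitz s t e : `|s - t| < e * r ->
  `|r / Num.max r s - r / Num.max r t| < e.
Proof.
rewrite -ltr_pdivrMr // => /(le_lt_trans _); apply.
have -> : r / Num.max r s - r / Num.max r t =
    (Num.max r t - Num.max r s) * (r / (Num.max r s * Num.max r t)).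
  by field; rewrite !gt_eqF.
rewrite normrM (ger0_norm (_ : 0 <= r / _)); last first.
  by rewrite divr_ge0 ?mulr_ge0 // ltW.
apply: ler_pM => //.
- by rewrite divr_ge0 ?mulr_ge0 // ltW.
- have := ler_norm (s - t); have := ler_norm (t - s).
  rewrite (distrC t s) (distrC _ (Num.max r s)) ler_norml.
  by case: (lerP r s); case: (lerP r t) => *; apply/andP; lra.
- rewrite ler_pdivrMr ?mulr_gt0 // mulrC ler_pdivlMr //.
  by rewrite ler_pM ?le_max ?lexx // ltW.
Qed.

(** Seen at a fibre where [a] has norm t, this bounds the norm of the difference
    between [a] and its truncation; it vanishes as t tends to r. *)
Lemma truncation_error t : 0 <= t -> `|r / Num.max r t - 1| * t <= `|t - r|.
Proof.
move=> t0; have -> : r / Num.max r t - 1 = (r - Num.max r t) / Num.max r t.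
  by field; rewrite gt_eqF.
rewrite normrM normfV (gtr0_norm (max_gt0 t)) mulrAC ler_pdivrMr //.
case: (lerP r t) => rt; rewrite ?subrr ?normr0 ?mul0r ?mulr_ge0 ?(ltW r_gt0) //.
  by rewrite distrC ger0_norm // subr_ge0.
by rewrite subr_ge0 ltW.
Qed.

End truncation.

(** * Limits of the fibre norms along a Cauchy sequence *)

(** The distance of I is valued in R and the norm of the target in R[i], so the
    epsilon-delta form needs the two uniform structures compared by hand. *)
Lemma UCbP {R : realType} {I : metricType R} (f : I -> R[i]^o) :
  UCb f <->
  (forall e : R, 0 < e -> exists2 d : R, 0 < d &
     forall x y, mdist x y < d -> `|f x - f y| < e%:C) /\
  exists M : R, forall x, `|f x| <= M%:C.
Proof.
split=> [[fu /pinfty_ex_gt0[_ /gt0_complex[M M0 ->] fM]]|[fu [M fM]]]; split.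
- move=> e e0; have eC0 : 0 < e%:C by rewrite ltr0c.
  have := fu _ (entourage_ball R[i]^o (PosNum eC0)).
  rewrite /= nbhs_simpl /= -entourage_ballE => -[d /= d0 dP].
  exists d => // x y xy; have := dP (x, y); rewrite /= ballEmdist -ball_normE /=.
  exact.
- by exists M => x; exact: fM.
- move=> U; rewrite -entourage_ballE => -[_ /= /gt0_complex[e e0 ->] eU].
  have [d d0 dP] := fu e e0.
  rewrite /= nbhs_simpl /= -entourage_ballE; exists d => // -[x y].
  rewrite /= ballEmdist => /dP xy; apply: eU.
  by rewrite -ball_normE.
- exists M%:C; split=> [|N MN x _]; first by rewrite complex_real.
  exact: le_trans (fM x) (ltW MN).
Qed.

Section bundle_theory.
Context {R : realType} {I : metricType R} (A : UCb_bundle I).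
Implicit Types (a b : sections A) (h : I) (e : R).

Lemma evD h a b : ev h (a + b) = ev h a + ev h b.
Proof. by have [lin _ _] := ev_hom A h; rewrite -[a]scale1r lin !scale1r. Qed.

Lemma evZ h c a : ev h (c *: a) = c *: ev h a.
Proof.
have [lin _ _] := ev_hom A h; have ev0 : ev h (0 : sections A) = 0.
  by have := lin (-1) 0 0; rewrite scaler0 addr0 scaleN1r addNr.
by have := lin c a 0; rewrite ev0 !addr0.
Qed.

Lemma evB h a b : ev h (a - b) = ev h a - ev h b.
Proof. by rewrite evD -scaleN1r evZ scaleN1r. Qed.

Lemma evM h a b : ev h (cmul a b) = cmul (ev h a) (ev h b).
Proof. by have [_ ->] := ev_hom A h. Qed.

Lemma ev_star h a : ev h (cstar a) = cstar (ev h a).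
Proof. by have [_ _ ->] := ev_hom A h. Qed.

Lemma rnorm_ev_unif a (e : R) : 0 < e -> exists2 d, 0 < d &
  forall h k, mdist h k < d -> `|rnorm (ev h a) - rnorm (ev k a)| < e.
Proof.
have [/(_ e) + _] := (UCbP _).1 (norm_ev_UCb a).
move=> /[apply] -[d d0 dP]; exists d => // h k /dP.
by rewrite -!rnormK -rmorphB /= normc_real ltcR.
Qed.

Lemma rnorm_ev_le h a : rnorm (ev h a) <= rnorm a.
Proof.
rewrite (norm_evE a); apply: ub_le_sup; last by exists h.
have [_ [M MP]] := (UCbP _).1 (norm_ev_UCb a).
exists M => _ [k _ <-]; have := MP k.
by rewrite normr_id -rnormK lecR.
Qed.

Lemma rnorm_le a (M : R) : 0 <= M ->
  (forall h, rnorm (ev h a) <= M) -> rnorm a <= M.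
Proof.
move=> M0 le_M; rewrite (norm_evE a).
have [->|/set0P S0] := eqVneq [set rnorm (ev h a) | h in [set: I]] set0.
  by rewrite sup0.
by apply: ge_sup => // _ [h _ <-].
Qed.

(** A Cauchy sequence of I stands for a point of the completion of I: uniform
    continuity of h |-> ||a(h)|| makes the norms converge along it. *)
Section limit_norm.
Variable u : nat -> I.
Hypothesis u_cauchy : cauchy (u @ \oo).

Definition limit_norm a : R := lim (rnorm (ev (u n) a) @[n --> \oo]).

Lemma limit_norm_cvg a : rnorm (ev (u n) a) @[n --> \oo] --> limit_norm a.
Proof.
suff : cvg (rnorm (ev (u n) a) @[n --> \oo]) by [].
apply/cauchy_cvgP/cauchy_exP => e e0.
have [d d0 dP] := rnorm_ev_unif a e0.
have [x ux] := (cauchyP (u @ \oo)).1 u_cauchy d d0.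
have near_x : \forall n \near \oo, mdist x (u n) < d.
  by move: ux; rewrite ballEmdist.
exists (rnorm (ev x a)); rewrite -ball_normE.
by apply: (@filterS _ \oo _ _ _ _ near_x) => n /= /dP.
Qed.

Arguments limit_norm_cvg : clear implicits.

Lemma limit_norm_eq a l : rnorm (ev (u n) a) @[n --> \oo] --> l -> limit_norm a = l.
Proof. exact: cvg_lim. Qed.

Lemma limit_norm_le a (g : nat -> R) l : g n @[n --> \oo] --> l ->
  (forall n, rnorm (ev (u n) a) <= g n) -> limit_norm a <= l.
Proof.
move=> gl le_g.
by apply: (ler_cvg_to (limit_norm_cvg a) gl); apply: nearW.
Qed.

Lemma limit_norm_ge0 a : 0 <= limit_norm a.
Proof.
apply: (cvgr_to_ge (limit_norm_cvg a)); apply: nearW => n; exact: rnorm_ge0.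
Qed.

Fact limit_normD a b : limit_norm (a + b) <= limit_norm a + limit_norm b.
Proof.
apply: limit_norm_le (cvgD (limit_norm_cvg a) (limit_norm_cvg b)) _ => n.
by rewrite /= evD rnormD.
Qed.

Fact limit_normZ c a : limit_norm (c *: a) = complex.Re `|c| * limit_norm a.
Proof.
apply: limit_norm_eq; under eq_fun do rewrite evZ rnormZ.
exact: cvgMr (limit_norm_cvg a).
Qed.

Fact limit_normM a b : limit_norm (cmul a b) <= limit_norm a * limit_norm b.
Proof.
apply: limit_norm_le (cvgM (limit_norm_cvg a) (limit_norm_cvg b)) _ => n.
by rewrite /= evM rnormM.
Qed.

Fact limit_normC a : limit_norm (cmul (cstar a) a) = limit_norm a ^+ 2.
Proof.
apply: limit_norm_eq; under eq_fun do rewrite evM ev_star rnormC expr2.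
rewrite expr2; exact: cvgM (limit_norm_cvg a) (limit_norm_cvg a).
Qed.

Fact limit_norm_le_norm a : limit_norm a <= rnorm a.
Proof. by apply: limit_norm_le (cvg_cst _) _ => n; exact: rnorm_ev_le. Qed.

Lemma limit_norm_eq0 a (g : nat -> R) : g n @[n --> \oo] --> 0 ->
  (forall n, rnorm (ev (u n) a) <= g n) -> limit_norm a = 0.
Proof.
by move=> g0 /(limit_norm_le g0) le0; apply/le_anti; rewrite le0 limit_norm_ge0.
Qed.

(** The lift is the truncation of [a] at height r, its limit norm: pointwise it is
    [a] times r / max(r, ||a(h)||).  When r = 0 this multiplier need not tend to 1,
    but then [a] itself lies in the kernel and the lift 0 will do. *)
Fact limit_norm_lift a :
  exists2 b, limit_norm (b - a) = 0 & rnorm b <= limit_norm a.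
Proof.
set r := limit_norm a.
have [r0|r0] := eqVneq r 0.
  exists 0; last by rewrite rnorm0 limit_norm_ge0.
  by rewrite sub0r -scaleN1r limit_normZ normrN1 mul1r.
have {r0} r_gt0 : 0 < r by rewrite lt_neqAle eq_sym r0 limit_norm_ge0.
pose g h := r / Num.max r (rnorm (ev h a)).
have max_gt0 h : 0 < Num.max r (rnorm (ev h a)) by rewrite lt_max r_gt0.
have g_ge0 h : 0 <= g h by rewrite divr_ge0 // ltW.
have g_le1 h : g h <= 1 by rewrite ler_pdivrMr // mul1r le_max lexx.
have g_UCb : UCb (fun h => (g h)%:C).
  apply/UCbP; split; last first.
    by exists 1 => h; rewrite normc_real lecR ger0_norm.
  move=> e e0; have [d d0 dP] := rnorm_ev_unif a (mulr_gt0 e0 r_gt0).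
  exists d => // h k /dP lt_e; rewrite -rmorphB /= normc_real ltcR.
  exact: truncation_lipschitz.
have [b bP] := ev_UCb_scale a g_UCb.
exists b; last first.
  apply: rnorm_le => [|h]; first exact: ltW.
  rewrite bP rnormZ normc_real /= ger0_norm //.
  by rewrite mulrAC ler_pdivrMr // ler_pM2l // le_max lexx orbT.
apply: (@limit_norm_eq0 _ (fun n => `|rnorm (ev (u n) a) - r|)).
  rewrite -(normr0 R); apply: cvg_norm; rewrite -(subrr r).
  exact: cvgB (limit_norm_cvg a) (cvg_cst r).
move=> n; rewrite evB bP -[X in _ - X]scale1r -scalerBl rnormZ.
rewrite -(rmorph1 (real_complex R)) -rmorphB normc_real /=.
by apply: truncation_error => //; exact: rnorm_ge0.
Qed.

Definition limit_seminorm : quotient_seminorm (sections A) :=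
  QuotientSeminorm limit_normD limit_normZ limit_normM limit_normC limit_norm_le_norm
    limit_norm_lift.

End limit_norm.

End bundle_theory.

(** * The extended bundle *)

(** The points of J are approximated by sequences u j of I.  Sequences are chosen
    once and for all; the seminorms do not depend on the choice, since they are
    continuous in j and prescribed on the dense image of alpha. *)
Section extension.
Context {R : realType} {I J : metricType R} (A : UCb_bundle I).
Variables (alpha : I -> J) (u : J -> nat -> I).
Hypothesis alpha_isom : forall x y, mdist (alpha x) (alpha y) = mdist x y.
Hypothesis u_cvg : forall j (e : R), 0 < e ->
  \forall n \near \oo, mdist (alpha (u j n)) j < e.

Fact approx_cauchy j : cauchy (u j @ \oo).
Proof.
apply: cauchy_exP => e e0; have e20 : 0 < e / 2 by rewrite divr_gt0.
have [n un] := filter_ex (u_cvg j e20).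
exists (u j n); rewrite ballEmdist.
apply: (@filterS _ \oo _ _ _ _ (u_cvg j e20)) => m /= um.
rewrite -alpha_isom (le_lt_trans (metric_triangle _ j _)) // [e]splitr.
by rewrite ltrD // metric_sym.
Qed.

Definition fiber_seminorm j := limit_seminorm A (approx_cauchy j).

Local Notation p := fiber_seminorm.
Local Notation fiber_cvg j a := (@limit_norm_cvg _ _ A _ (approx_cauchy j) a).

Lemma fiber_seminormE j a : p j a = limit_norm (u j) a.
Proof. by []. Qed.

Lemma fiber_seminorm_image h a : p (alpha h) a = rnorm (ev h a).
Proof.
rewrite fiber_seminormE; apply: limit_norm_eq; apply/cvgrPdist_lt => e e0.
have [d d0 dP] := rnorm_ev_unif a e0.
apply: (@filterS _ \oo _ _ _ _ (u_cvg (alpha h) d0)) => n /= un.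
by apply: dP; rewrite metric_sym -alpha_isom.
Qed.

(** The same modulus serves for J up to a factor 2 in the values: if i and j are
    closer than d, so are u i n and u j n for large n, because alpha is isometric;
    the strict inequality of values becomes a large one in the limit. *)
Lemma fiber_seminorm_unif a (e : R) : 0 < e -> exists2 d, 0 < d &
  forall i j, mdist i j < d -> `|p i a - p j a| < e.
Proof.
move=> e0; have e20 : 0 < e / 2 by rewrite divr_gt0.
have [d d0 dP] := rnorm_ev_unif a e20.
exists d => // i j ij.
have gap : 0 < (d - mdist i j) / 2 by rewrite divr_gt0 // subr_gt0.
apply: (@le_lt_trans _ _ (e / 2)); last by rewrite ltr_pdivrMr // ltr_pMr // ltr1n.
apply: (cvgr_to_le (cvg_norm (cvgB (fiber_cvg i a) (fiber_cvg j a)))).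
apply: filterS (filterI (u_cvg i gap) (u_cvg j gap)) => n [ui uj] /=.
apply/ltW/dP; rewrite -alpha_isom.
apply: (le_lt_trans (metric_triangle _ i _)).
rewrite (le_lt_trans (lerD (lexx _) (metric_triangle _ j _))) //.
rewrite (metric_sym j (alpha _)); lra.
Qed.

Fact fiber_ev_hom j : star_hom (qproj (p j)).
Proof. exact: qproj_star_hom. Qed.

Fact fiber_ev_surj j (b : quotient_alg (p j)) : exists a, qproj (p j) a = b.
Proof. by exists (qrepr b); rewrite qreprK. Qed.

Fact fiber_norm_evE (a : sections A) :
  rnorm a = sup [set rnorm (qproj (p j) a : quotient_alg (p j)) | j in [set: J]].
Proof.
(* Every p_j is at most the norm, and the values over alpha(I) alone have the norm
   as their supremum.  An empty J is treated apart because the supremum is seen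
   to be nonnegative by comparing it with a member of S. *)
set S := [set _ | _ in _].
have ubS : ubound S (rnorm a) by move=> _ [j _ <-]; rewrite rnorm_qproj qnorm_le.
have supS : has_ubound S by exists (rnorm a).
have [S0|/set0P S_neq0] := eqVneq S set0.
  apply/le_anti; rewrite S0 sup0 rnorm_ge0 andbT.
  apply: rnorm_le => // h; suff : S (rnorm (ev h a)) by rewrite S0.
  by exists (alpha h) => //; rewrite rnorm_qproj fiber_seminorm_image.
apply/le_anti/andP; split; last exact: ge_sup.
have [_ [j _ _]] := S_neq0.
apply: rnorm_le => [|h]; last first.
  apply: ub_le_sup => //.
  by exists (alpha h) => //; rewrite rnorm_qproj fiber_seminorm_image.
apply: le_trans (rnorm_ge0 (qproj (p j) a : quotient_alg (p j))) _.
by apply: ub_le_sup => //; exists j.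
Qed.

Fact fiber_UCb_scale (f : J -> R[i]^o) (a : sections A) : UCb f ->
  exists fa, forall j, qproj (p j) fa = f j *: qproj (p j) a.
Proof.
move=> /UCbP[fu [M fM]].
have /(ev_UCb_scale a)[fa faP] : UCb (f \o alpha).
  apply/UCbP; split=> [e /fu[d d0 dP]|]; last by exists M => h; exact: fM.
  by exists d => // h k hk; apply: dP; rewrite alpha_isom.
exists fa => j; rewrite -qprojZ; apply/qproj_eq.
(* Along u j, fa - f(j) a has norm at most |f(alpha(u j n)) - f(j)| ||a||. *)
pose g n := complex.Re `|f (alpha (u j n)) - f j|.
apply: (@limit_norm_eq0 _ _ _ _ (approx_cauchy j) _ (fun n => g n * rnorm a)).
  rewrite -(mul0r (rnorm a)); apply: cvgMl.
  apply/cvgrPdist_lt => e /fu[d d0 dP].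
  apply: (@filterS _ \oo _ _ _ _ (u_cvg j d0)) => n /= /dP f_near.
  rewrite sub0r normrN (ger0_norm (Re_normc_ge0 _)).
  by rewrite -ltcR Re_normcK.
move=> n; rewrite evB evZ faP /= -scalerBl rnormZ ler_wpM2l ?rnorm_ev_le //.
exact: Re_normc_ge0.
Qed.

Fact fiber_norm_UCb (a : sections A) :
  UCb (fun j => `|qproj (p j) a : quotient_alg (p j)|).
Proof.
apply/UCbP; split=> [e e0|].
  have [d d0 dP] := fiber_seminorm_unif a e0; exists d => // i j /dP.
  by rewrite !norm_qproj -rmorphB normc_real ltcR.
exists (rnorm a) => j; rewrite norm_qproj normc_real lecR.
by rewrite ger0_norm ?qnorm_ge0 ?qnorm_le.
Qed.

Definition extension : UCb_bundle J :=
  @UCbBundle R J (fun j => quotient_alg (p j)) (sections A) (fun j => qproj (p j))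
    fiber_ev_hom fiber_ev_surj fiber_norm_evE fiber_UCb_scale fiber_norm_UCb.

Lemma extension_minimal :
  dense (range alpha) -> minimal_extension A extension alpha.
Proof.
move=> alpha_dense; exists id; split=> //.
- split=> // [|x y xy]; last first.
    by apply: mdist_positivity; rewrite -alpha_isom xy mdistxx.
  split=> [x y|//|a1 a2 h a12]; first by rewrite alpha_isom.
  apply/qproj_eq; rewrite fiber_seminorm_image evB a12 subrr; exact: rnorm0.
- by move=> U [x Ux] _; exists x; split=> //; exists x.
Qed.

End extension.

Theorem theorem4p1 (R : realType) (I J : metricType R)
    (I_lc : locally_compact [set: I]) (J_lc : locally_compact [set: J])
    (A : UCb_bundle I) (alpha : I -> J)
    (alpha_emb : dense_isometric_embedding alpha) :
  exists B : UCb_bundle J, minimal_extension A B alpha.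
Proof.
have [alpha_isom alpha_dense] := alpha_emb.
have /choice[u uP] : forall j, exists v : nat -> I,
    forall n, mdist (alpha (v n)) j < n.+1%:R^-1.
  move=> j.
  have /choice[v vP] : forall n, exists i, mdist (alpha i) j < n.+1%:R^-1.
    move=> n; have n0 : 0 < n.+1%:R^-1 :> R by rewrite invr_gt0.
    have ball_j : (ball j n.+1%:R^-1)° !=set0 by exists j; exact: nbhsx_ballx.
    have [x [/interior_subset jx [i _ ix]]] :=
      alpha_dense _ ball_j (@open_interior _ _).
    by exists i; move: jx; rewrite ballEmdist /= -ix metric_sym.
  by exists v.
have u_cvg j (e : R) : 0 < e -> \forall n \near \oo, mdist (alpha (u j n)) j < e.
  move=> e0; near=> n; apply: lt_trans (uP j n) _.
  by near: n; exact: near_infty_natSinv_lt (PosNum e0).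
by exists (extension A alpha_isom u_cvg); exact: extension_minimal.
Unshelve. all: by end_near. Qed.
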